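(* Let $\mathfrak A$ be a $C^*$-algebra and let $\sigma:\mathfrak A\to\mathfrak A$ be a $*$-homomorphism. Then $\mathfrak A$ is $\sigma$-amenable if and only if $\sigma(\mathfrak A)$ is amenable. Likewise, $\mathfrak A$ is $\sigma$-contractible if and only if $\sigma(\mathfrak A)$ is contractible.
   Context: Let $\mathcal A$ be a (complex) Banach algebra and $\sigma:\mathcal A\to\mathcal A$ a linear map whose image is a subalgebra of $\mathcal A$. A Banach $\sigma(\mathcal A)$-bimodule is a Banach space with commuting bounded left and right $\sigma(\mathcal A)$-module actions. A linear map $D:\mathcal A\to\mathcal X$ into a $\sigma(\mathcal A)$-bimodule $\mathcal X$ is a $\sigma$-derivation if $D(ab)=D(a)\cdot\sigma(b)+\sigma(a)\cdot D(b)$ for all $a,b\in\mathcal A$. A $\sigma$-derivation $D$ is $\sigma$-inner if there is $x\in\mathcal X$ such that either $D(a)=x\cdot\sigma(a)-\sigma(a)\cdot x$ for all $a\in\mathcal A$, or $D(a)=x\cdot\sigma(a)+\sigma(a)\cdot x$ for all $a\in\mathcal A$. A dual Banach $\sigma(\mathcal A)$-bimodule is the dual $\mathcal Y^*$ of a Banach $\sigma(\mathcal A)$-bimodule $\mathcal Y$, with actions $(b\cdot f)(y)=f(yb)$ and $(f\cdot b)(y)=f(by)$ for $b\in\sigma(\mathcal A)$, $f\in\mathcal Y^*$, $y\in\mathcal Y$. $\mathcal A$ is $\sigma$-amenable if every continuous $\sigma$-derivation from $\mathcal A$ into any dual Banach $\sigma(\mathcal A)$-bimodule is $\sigma$-inner;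 it is $\sigma$-contractible if every continuous $\sigma$-derivation from $\mathcal A$ into any Banach $\sigma(\mathcal A)$-bimodule is $\sigma$-inner. Amenable and contractible have the usual meaning: every continuous derivation from the Banach algebra into any dual Banach bimodule (respectively, any Banach bimodule) over it is inner, i.e. of the form $a\mapsto x\cdot a-a\cdot x$. *)

(* Defs.v *)
From HB Require Import structures.
From mathcomp Require Import all_boot all_order all_algebra.
From mathcomp Require Import complex.
From mathcomp Require Import boolp classical_sets functions reals.
From mathcomp Require Import topology normedtype.

Set Implicit Arguments.
Unset Strict Implicit.
Unset Printing Implicit Defensive.

Import Order.TTheory GRing.Theory Num.Theory.
Import numFieldNormedType.Exports.

Local Open Scope classical_set_scope.
Local Open Scope ring_scope.
Local Open Scope complex_scope.

Reserved Notation "a ** b" (at level 40, left associativity).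

(* Algebras are not assumed unital, so MathComp's ring structures do not apply
   and the product is a separate operation. *)
HB.mixin Record NormedModule_isNormedAlg (R : realType) A
    of NormedModule R[i] A := {
  amul : A -> A -> A ;
  amulA : associative amul ;
  amulDl : left_distributive amul +%R ;
  amulDr : right_distributive amul +%R ;
  amulZl : forall (k : R[i]) a b, amul (k *: a) b = k *: amul a b ;
  amulZr : forall (k : R[i]) a b, amul a (k *: b) = k *: amul a b ;
  ler_norm_amul : forall a b, `|amul a b| <= `|a| * `|b|
}.

#[short(type="normedAlgType")]
HB.structure Definition NormedAlg (R : realType) :=
  {A of NormedModule R[i] A & NormedModule_isNormedAlg R A}.

Notation "a ** b" := (amul a b) : ring_scope.

#[short(type="banachAlgType")]
HB.structure Definition BanachAlg (R : realType) :=
  {A of NormedAlg R A & Complete A}.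

HB.mixin Record BanachAlg_isCStarAlg (R : realType) A of BanachAlg R A := {
  star : A -> A ;
  starK : involutive star ;
  starD : {morph star : a b / a + b} ;
  starZ : forall (k : R[i]) a, star (k *: a) = k^* *: star a ;
  starM : forall a b, star (a ** b) = star b ** star a ;
  cstar_norm : forall a, `|star a ** a| = `|a| ^+ 2
}.

#[short(type="cstarAlgType")]
HB.structure Definition CStarAlg (R : realType) :=
  {A of BanachAlg R A & BanachAlg_isCStarAlg R A}.

Section DualSpace.
Context {R : realType} (Y : normedModType R[i]).

Definition dual_pred : {pred Y -> R[i]^o} :=
  fun f => `[< linear f /\ continuous f >].

Record dual := Dual {
  dual_fun :> Y -> R[i]^o ;
  _ : dual_fun \in dual_pred
}.

HB.instance Definition _ := [isSub for dual_fun].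
HB.instance Definition _ := [Choice of dual by <:].

Lemma dual_predP (f : Y -> R[i]^o) : reflect (linear f /\ continuous f) (f \in dual_pred).
Proof. exact: asboolP. Qed.

Lemma dual_pred_submod : submod_closed dual_pred.
Proof.
split=> [|k f g /dual_predP[lf cf] /dual_predP[lg cg]]; apply/dual_predP.
  split=> [a u v|x]; last exact: cst_continuous.
  by rewrite (_ : forall u, (0 : Y -> R[i]^o) u = 0) // scaler0 addr0.
split=> [a u v|x].
  rewrite /GRing.add /= /GRing.scale /= lf lg.
  rewrite /GRing.scale /= !mulrDr -/(GRing.add _ _) addrACA.
  by rewrite [k * _]mulrCA.
apply: (@continuousD _ _ _ (fun y => k *: f y) g); last exact: cg.
by apply: continuousZl_tmp; exact: cf.
Qed.

HB.instance Definition _ :=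
  GRing.isSubmodClosed.Build R[i] (Y -> R[i]^o) dual_pred dual_pred_submod.
HB.instance Definition _ := [SubChoice_isSubLmodule of dual by <:].

Lemma dual_linear (f : dual) : linear f.
Proof. by case: f => f /= /dual_predP[]. Qed.

Lemma dual_continuous (f : dual) : continuous f.
Proof. by case: f => f /= /dual_predP[]. Qed.

Definition dual_norm (f : dual) : R :=
  sup [set complex.Re `|f y| | y in [set y | `|y| <= 1]].

Lemma dual_ext (f g : dual) : f =1 g -> f = g.
Proof. by move=> fg; apply/val_inj/funext. Qed.

Lemma dualD (f g : dual) y : (f + g) y = f y + g y.
Proof. by []. Qed.

Lemma dualZ (k : R[i]) (f : dual) y : (k *: f) y = k * f y.
Proof. by []. Qed.

Lemma dual0 y : (0 : dual) y = 0.
Proof. by []. Qed.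

Lemma dual_scale (f : dual) (k : R[i]) y : f (k *: y) = k * f y.
Proof.
pose F : {linear Y -> R[i]^o} := HB.pack (f : Y -> R[i]^o)
  (GRing.isLinear.Build _ _ _ _ (f : Y -> R[i]^o) (dual_linear f)).
exact: (linearZZ F k y).
Qed.

Lemma dual_bounded (f : dual) :
  exists2 M : R, 0 <= M & forall y, `|f y| <= M%:C * `|y|.
Proof.
pose F : {linear Y -> R[i]^o} := HB.pack (f : Y -> R[i]^o)
  (GRing.isLinear.Build _ _ _ _ (f : Y -> R[i]^o) (dual_linear f)).
have /linear_boundedP : bounded_near F (nbhs (0 : Y)).
  by apply/linear_bounded_continuous; exact: dual_continuous.
move=> /pinfty_ex_gt0[r r0 rF].
exists (complex.Re r) => [|y].
  by move: r0; rewrite ltcE => /andP[_ /ltW].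
by rewrite RRe_real ?gtr0_real//; exact: rF.
Qed.

Let ball_img (f : dual) := [set complex.Re `|f y| | y in [set y | `|y| <= 1]].

Lemma dual_norm_has_sup (f : dual) : has_sup (ball_img f).
Proof.
split; first by exists (complex.Re `|f 0|), 0 => //=; rewrite normr0.
have [M M0 fM] := dual_bounded f; exists M => _ [y /= y1 <-].
have : `|f y| <= M%:C.
  apply: le_trans (fM y) _; rewrite -[leRHS]mulr1 ler_wpM2l//.
  by rewrite lecE /= eqxx.
by rewrite lecE => /andP[].
Qed.

Lemma Re_normK (V : normedModType R[i]) (v : V) : (complex.Re `|v|)%:C = `|v|.
Proof. by rewrite RRe_real// ger0_real. Qed.

Lemma dual_norm_ge0 (f : dual) : 0 <= dual_norm f.
Proof.
apply: (@le_trans _ _ (complex.Re `|f 0|)).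
  by have := normr_ge0 (f 0); rewrite lecE => /andP[].
apply: sup_upper_bound; first exact: dual_norm_has_sup.
by exists 0 => //=; rewrite normr0.
Qed.

Lemma ler_dual_norm (f : dual) y : `|f y| <= (dual_norm f)%:C * `|y|.
Proof.
have [->|y0] := eqVneq y 0.
  have [M M0 fM] := dual_bounded f.
  by apply: le_trans (fM 0) _; rewrite normr0 !mulr0.
have ny0 : 0 < `|y| by rewrite normr_gt0.
rewrite -ler_pdivrMr//.
have : `|f (`|y|^-1 *: y)| <= (dual_norm f)%:C.
  rewrite -(Re_normK (_ : R[i]^o)) lecR.
  apply: sup_upper_bound; first exact: dual_norm_has_sup.
  exists (`|y|^-1 *: y) => //=.
  by rewrite normrZ normfV normr_id mulVf// gt_eqF.
by rewrite dual_scale normrM normfV normr_id mulrC.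
Qed.

Lemma dual_norm_le (f : dual) (M : R) :
  (forall y, `|y| <= 1 -> `|f y| <= M%:C) -> dual_norm f <= M.
Proof.
move=> fM; apply: ge_sup; first by have [] := dual_norm_has_sup f.
by move=> _ [y /= /fM + <-]; rewrite lecE => /andP[].
Qed.

Let dual_unit_ball (f : dual) y : `|y| <= 1 -> `|f y| <= (dual_norm f)%:C.
Proof.
move=> y1; apply: le_trans (ler_dual_norm f y) _.
by rewrite -[leRHS]mulr1 ler_wpM2l// lecR dual_norm_ge0.
Qed.

Let dual_normC (f : dual) : R[i] := (dual_norm f)%:C.

Lemma dual_normD f g : dual_normC (f + g) <= dual_normC f + dual_normC g.
Proof.
rewrite /dual_normC -rmorphD lecR; apply: dual_norm_le => y y1.
by rewrite rmorphD; apply: le_trans (ler_normD _ _) _; rewrite lerD ?dual_unit_ball.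
Qed.

Lemma dual_normZ (k : R[i]) f : dual_normC (k *: f) = `|k| * dual_normC f.
Proof.
have le_normZ c g : dual_normC (c *: g) <= `|c| * dual_normC g.
  have cE : (complex.Re `|c|)%:C = `|c| by rewrite RRe_real ?normr_real.
  rewrite /dual_normC -cE -rmorphM lecR; apply: dual_norm_le => y y1.
  by rewrite dualZ normrM rmorphM /= cE ler_wpM2l// dual_unit_ball.
apply/eqP; rewrite eq_le le_normZ/=.
have [->|k0] := eqVneq k 0.
  by rewrite normr0 mul0r /dual_normC (_ : 0 = 0%:C)// lecR dual_norm_ge0.
rewrite -ler_pdivlMl ?normr_gt0//.
by have := le_normZ k^-1 (k *: f); rewrite scalerA mulVf// scale1r normfV.
Qed.

Lemma dual_norm0_eq0 f : dual_normC f = 0 -> f = 0.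
Proof.
move=> f0; apply: dual_ext => y; apply/eqP; rewrite -normr_le0.
by apply: le_trans (ler_dual_norm f y) _; rewrite [_%:C]f0 mul0r.
Qed.

HB.instance Definition _ :=
  Lmodule_isNormed.Build R[i] dual dual_normD dual_normZ dual_norm0_eq0.

Lemma dual_normE f : `|f| = (dual_norm f)%:C.
Proof. by []. Qed.

End DualSpace.

Arguments dual_pred {R} Y.

(* Boundedness of the actions is joint boundedness, as usual for Banach
   modules. Completeness of X is not part of the record: Banach bimodules are
   those with X : completeNormedModType R[i]. *)
Record bimodule (R : realType) (B : normedAlgType R) (X : normedModType R[i])
    := Bimodule {
  lact : B -> X -> X ;
  ract : X -> B -> X ;
  lact_linearl : forall x, linear (lact^~ x) ;
  lact_linearr : forall b, linear (lact b) ;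
  ract_linearl : forall b, linear (ract^~ b) ;
  ract_linearr : forall x, linear (ract x) ;
  lactA : forall a b x, lact (a ** b) x = lact a (lact b x) ;
  ractA : forall x a b, ract x (a ** b) = ract (ract x a) b ;
  lractA : forall a x b, ract (lact a x) b = lact a (ract x b) ;
  lact_bounded : exists M : R, forall b x, `|lact b x| <= M%:C * `|b| * `|x| ;
  ract_bounded : exists M : R, forall x b, `|ract x b| <= M%:C * `|x| * `|b|
}.

Section DualBimodule.
Context {R : realType} (B : normedAlgType R) (Y : normedModType R[i]).
Variable M : bimodule B Y.

Lemma bounded_dual_pred (g : Y -> R[i]^o) (C : R[i]) :
  linear g -> (forall y, `|g y| <= C * `|y|) -> g \in dual_pred Y.
Proof.
move=> lg gC; apply/dual_predP; split=> //.
pose G : {linear Y -> R[i]^o} := HB.pack g (GRing.isLinear.Build _ _ _ _ g lg).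
apply: (@bounded_linear_continuous _ _ _ G).
have C0 (y : Y) : 0 <= C * `|y| by exact: le_trans (normr_ge0 _) (gC y).
apply/bounded_funP => r; exists (`|C| * `|r|) => x xr.
apply: le_trans (gC x) _; rewrite -(ger0_norm (C0 x)) normrM normr_id.
rewrite ler_wpM2l//; apply: (le_trans xr).
by rewrite real_ler_norm// ger0_real// (le_trans _ xr).
Qed.

Fact dual_lact_subproof (b : B) (f : dual Y) :
  (fun y => f (ract M y b)) \in dual_pred Y.
Proof.
have [N Nb] := ract_bounded M.
apply: (@bounded_dual_pred _ ((dual_norm f)%:C * (N%:C * `|b|))).
  by move=> k u v; rewrite ract_linearl dual_linear.
move=> y; apply: le_trans (ler_dual_norm f _) _.
by rewrite -mulrA ler_wpM2l ?lecR ?dual_norm_ge0// mulrAC; exact: Nb.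
Qed.

Fact dual_ract_subproof (f : dual Y) (b : B) :
  (fun y => f (lact M b y)) \in dual_pred Y.
Proof.
have [N Nb] := lact_bounded M.
apply: (@bounded_dual_pred _ ((dual_norm f)%:C * (N%:C * `|b|))).
  by move=> k u v; rewrite lact_linearr dual_linear.
move=> y; apply: le_trans (ler_dual_norm f _) _.
by rewrite -mulrA ler_wpM2l ?lecR ?dual_norm_ge0//; exact: Nb.
Qed.

Definition dual_lact (b : B) (f : dual Y) : dual Y :=
  Dual (dual_lact_subproof b f).
Definition dual_ract (f : dual Y) (b : B) : dual Y :=
  Dual (dual_ract_subproof f b).

Let dual_opnorm (g f : dual Y) (N : R) (b : B) : 0 <= N ->
  (forall y, `|g y| <= (dual_norm f)%:C * (N%:C * `|b| * `|y|)) ->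
  `|g| <= N%:C * `|b| * `|f|.
Proof.
move=> N0 gN; rewrite !dual_normE -(Re_normK b) -!rmorphM lecR.
apply: dual_norm_le => y y1; apply: le_trans (gN y) _.
rewrite !rmorphM /= Re_normK [leRHS]mulrC ler_wpM2l ?lecR ?dual_norm_ge0//.
by rewrite ler_piMr// mulr_ge0// lecR.
Qed.

Fact dual_lact_linearl f : linear (dual_lact^~ f).
Proof.
by move=> k a b; apply: dual_ext => y /=; rewrite ract_linearr dual_linear.
Qed.

Fact dual_lact_linearr b : linear (dual_lact b).
Proof. by move=> k f g; apply: dual_ext => y. Qed.

Fact dual_ract_linearl b : linear (dual_ract^~ b).
Proof. by move=> k f g; apply: dual_ext => y. Qed.

Fact dual_ract_linearr f : linear (dual_ract f).
Proof.
by move=> k a b; apply: dual_ext => y /=; rewrite lact_linearl dual_linear.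
Qed.

Fact dual_lactA a b f : dual_lact (a ** b) f = dual_lact a (dual_lact b f).
Proof. by apply: dual_ext => y /=; rewrite ractA. Qed.

Fact dual_ractA f a b : dual_ract f (a ** b) = dual_ract (dual_ract f a) b.
Proof. by apply: dual_ext => y /=; rewrite lactA. Qed.

Fact dual_lractA a f b :
  dual_ract (dual_lact a f) b = dual_lact a (dual_ract f b).
Proof. by apply: dual_ext => y /=; rewrite lractA. Qed.

Let bound_norm (N : R) (u v w : R[i]) : 0 <= u -> 0 <= v ->
  w <= N%:C * u * v -> w <= `|N|%:C * u * v.
Proof.
move=> u0 v0 /le_trans; apply; rewrite -!mulrA ler_wpM2r ?mulr_ge0//.
by rewrite lecR ler_norm.
Qed.

Fact dual_lact_bounded :
  exists N : R, forall b f, `|dual_lact b f| <= N%:C * `|b| * `|f|.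
Proof.
have [N Nb] := ract_bounded M; exists `|N| => b f.
apply: dual_opnorm => // y; apply: le_trans (ler_dual_norm f _) _.
rewrite ler_wpM2l ?lecR ?dual_norm_ge0// mulrAC.
exact/bound_norm/Nb.
Qed.

Fact dual_ract_bounded :
  exists N : R, forall f b, `|dual_ract f b| <= N%:C * `|f| * `|b|.
Proof.
have [N Nb] := lact_bounded M; exists `|N| => f b; rewrite mulrAC.
apply: dual_opnorm => // y; apply: le_trans (ler_dual_norm f _) _.
rewrite ler_wpM2l ?lecR ?dual_norm_ge0//.
exact/bound_norm/Nb.
Qed.

Definition dual_bimodule : bimodule B (dual Y) :=
  Bimodule dual_lact_linearl dual_lact_linearr
    dual_ract_linearl dual_ract_linearr
    dual_lactA dual_ractA dual_lractA dual_lact_bounded dual_ract_bounded.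

End DualBimodule.

(* A linear map whose image is a subalgebra. *)
Record subalgMap (R : realType) (A : banachAlgType R) := SubalgMap {
  subalg_fun :> {linear A -> A} ;
  subalg_funM : forall a b, range subalg_fun (subalg_fun a ** subalg_fun b)
}.

Section ImageAlgebra.
Context {R : realType} {A : banachAlgType R} (s : subalgMap A).

Definition image_pred : {pred A} := fun b => `[< range s b >].

Record image_alg := ImageAlg {
  image_val :> A ;
  _ : image_val \in image_pred
}.

HB.instance Definition _ := [isSub for image_val].
HB.instance Definition _ := [Choice of image_alg by <:].

Lemma image_pred_submod : submod_closed image_pred.
Proof.
split; first by apply/asboolP; exists 0 => //; rewrite linear0.
move=> k _ _ /asboolP[a _ <-] /asboolP[b _ <-]; apply/asboolP.
by exists (k *: a + b) => //; rewrite linearP.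
Qed.

HB.instance Definition _ :=
  GRing.isSubmodClosed.Build R[i] A image_pred image_pred_submod.
HB.instance Definition _ := [SubChoice_isSubLmodule of image_alg by <:].

Let image_norm (b : image_alg) : R[i] := `|val b|.

Let image_normD b c : image_norm (b + c) <= image_norm b + image_norm c.
Proof. exact: ler_normD. Qed.

Let image_normZ (k : R[i]) b : image_norm (k *: b) = `|k| * image_norm b.
Proof. exact: normrZ. Qed.

Let image_norm0_eq0 b : image_norm b = 0 -> b = 0.
Proof. by move=> /normr0_eq0 b0; apply: val_inj. Qed.

HB.instance Definition _ :=
  Lmodule_isNormed.Build R[i] image_alg image_normD image_normZ image_norm0_eq0.

Fact image_mul_subproof (b c : image_alg) : val b ** val c \in image_pred.
Proof.
case: b c => [b /= /asboolP[x _ <-]] [c /= /asboolP[y _ <-]].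
exact/asboolP/subalg_funM.
Qed.

Definition image_mul (b c : image_alg) : image_alg :=
  ImageAlg (image_mul_subproof b c).

Let image_mulA : associative image_mul.
Proof. by move=> a b c; apply: val_inj; exact: amulA. Qed.

Let image_mulDl : left_distributive image_mul +%R.
Proof. by move=> a b c; apply: val_inj; exact: amulDl. Qed.

Let image_mulDr : right_distributive image_mul +%R.
Proof. by move=> a b c; apply: val_inj; exact: amulDr. Qed.

Let image_mulZl (k : R[i]) a b : image_mul (k *: a) b = k *: image_mul a b.
Proof. by apply: val_inj; exact: amulZl. Qed.

Let image_mulZr (k : R[i]) a b : image_mul a (k *: b) = k *: image_mul a b.
Proof. by apply: val_inj; exact: amulZr. Qed.

Let image_norm_mul a b : `|image_mul a b| <= `|a| * `|b|.
Proof. exact: ler_norm_amul. Qed.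

HB.instance Definition _ := NormedModule_isNormedAlg.Build R image_alg
  image_mulA image_mulDl image_mulDr image_mulZl image_mulZr image_norm_mul.

Lemma image_normE (b : image_alg) : `|b| = `|val b|.
Proof. by []. Qed.

Fact corestrict_subproof a : s a \in image_pred.
Proof. by apply/asboolP; exists a. Qed.

Definition corestrict (a : A) : image_alg := ImageAlg (corestrict_subproof a).

End ImageAlgebra.

Section Derivations.
Context {R : realType} {A B : normedAlgType R} {X : normedModType R[i]}.
Variables (s : A -> B) (M : bimodule B X).

Definition derivation (D : A -> X) : Prop :=
  forall a b, D (a ** b) = ract M (D a) (s b) + lact M (s a) (D b).

Definition inner (D : A -> X) : Prop :=
  exists x, forall a, D a = ract M x (s a) - lact M (s a) x.

Definition skew_inner (D : A -> X) : Prop :=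
  exists x, forall a, D a = ract M x (s a) + lact M (s a) x.

End Derivations.

Definition sigma_amenable (R : realType) (A : banachAlgType R)
    (s : subalgMap A) : Prop :=
  forall (Y : completeNormedModType R[i]) (M : bimodule (image_alg s) Y)
         (D : {linear A -> dual Y}),
    continuous D -> derivation (corestrict s) (dual_bimodule M) D ->
    inner (corestrict s) (dual_bimodule M) D
    \/ skew_inner (corestrict s) (dual_bimodule M) D.

Definition sigma_contractible (R : realType) (A : banachAlgType R)
    (s : subalgMap A) : Prop :=
  forall (X : completeNormedModType R[i]) (M : bimodule (image_alg s) X)
         (D : {linear A -> X}),
    continuous D -> derivation (corestrict s) M D ->
    inner (corestrict s) M D \/ skew_inner (corestrict s) M D.

(* Stated for normed algebras, so that they can be applied to the image of a
   *-homomorphism of C*-algebras without first proving that it is complete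
   (it always is). *)
Definition amenable (R : realType) (B : normedAlgType R) : Prop :=
  forall (Y : completeNormedModType R[i]) (M : bimodule B Y)
         (D : {linear B -> dual Y}),
    continuous D -> derivation idfun (dual_bimodule M) D ->
    inner idfun (dual_bimodule M) D.

Definition contractible (R : realType) (B : normedAlgType R) : Prop :=
  forall (X : completeNormedModType R[i]) (M : bimodule B X)
         (D : {linear B -> X}),
    continuous D -> derivation idfun M D -> inner idfun M D.

Record starHom (R : realType) (A : cstarAlgType R) := StarHom {
  starhom_fun :> {linear A -> A} ;
  starhomM : forall a b, starhom_fun (a ** b) = starhom_fun a ** starhom_fun b ;
  starhomS : forall a, starhom_fun (star a) = star (starhom_fun a)
}.

Fact starhom_subalg_subproof (R : realType) (A : cstarAlgType R)
    (s : starHom A) (a b : A) : range s (s a ** s b).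
Proof. by exists (a ** b) => //; rewrite starhomM. Qed.

Definition starhom_subalg (R : realType) (A : cstarAlgType R) (s : starHom A) :
  subalgMap A := SubalgMap (starhom_subalg_subproof s).

(* Main.v *)
Require Import Defs.
From HB Require Import structures.
From mathcomp Require Import all_boot all_order all_algebra.
From mathcomp Require Import complex.
From mathcomp Require Import boolp classical_sets functions reals.
From mathcomp Require Import topology normedtype.
From mathcomp Require Import ring lra.

(* A skew-inner sigma-derivation a |-> x.a + a.x satisfies a.x.b = 0. If w is an
   element with w.b = 0 and b.w = b.x, then x - 2w implements it as an inner one.
   Such a w is obtained by applying the hypothesis on A once more, to sigma seen
   as a derivation into sigma(A), or into its bidual, with zero right action:
   this yields a right unit u of sigma(A) (take w = u.x), respectively a
   functional E on the dual of sigma(A) with E(f.b) = f(b) (take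
   w(y) = E(b |-> x(yb))).
   Passing between derivations on sigma(A) and sigma-derivations on A requires
   that sigma is bounded, that bounded elements of sigma(A) have bounded lifts,
   and that sigma-derivations vanish on ker sigma. Only the C*-identity is used:
   a self-adjoint a has Cayley transforms q = a (a + i l)^-1, l > 0, with
   norm at most 1 because 1 - 2q is unitary. Then i l q is a bounded lift of
   an approximation of sigma(a), and a q approximates a. Boundedness of sigma
   holds because a small self-adjoint h is the imaginary part of a unitary. *)

Set Implicit Arguments.
Unset Strict Implicit.
Unset Printing Implicit Defensive.

Import Order.TTheory GRing.Theory Num.Theory.
Import numFieldNormedType.Exports.

Local Open Scope classical_set_scope.
Local Open Scope ring_scope.
Local Open Scope complex_scope.

(** * Real-valued norms, so that estimates take place over [R] *)

Definition nrm (R : realType) (V : normedModType R[i]) (v : V) : R :=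
  complex.Re `|v|.

Section RealNorm.
Context {R : realType} {V : normedModType R[i]}.
Implicit Types u v w : V.

Lemma nrmE v : (nrm v)%:C = `|v|.
Proof. exact: Re_normK. Qed.

Lemma nrm_ge0 v : 0 <= nrm v.
Proof. by rewrite -lecR nrmE normr_ge0. Qed.

Lemma nrm0 : nrm (0 : V) = 0.
Proof. by rewrite /nrm normr0. Qed.

Lemma nrm_eq0 v : nrm v = 0 -> v = 0.
Proof. by move=> v0; apply: normr0_eq0; rewrite -nrmE v0. Qed.

Lemma nrm_le0 v : nrm v <= 0 -> v = 0.
Proof. by move=> v0; apply: nrm_eq0; apply/eqP; rewrite eq_le v0 nrm_ge0. Qed.

Lemma nrmD u v : nrm (u + v) <= nrm u + nrm v.
Proof. by rewrite -lecR rmorphD /= !nrmE ler_normD. Qed.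

Lemma nrmN v : nrm (- v) = nrm v.
Proof. by rewrite /nrm normrN. Qed.

Lemma nrmBC u v : nrm (u - v) = nrm (v - u).
Proof. by rewrite -opprB nrmN. Qed.

Lemma nrmB u v : nrm (u - v) <= nrm u + nrm v.
Proof. by rewrite -(nrmN v) nrmD. Qed.

Lemma nrm_dist w u v : nrm (u - v) <= nrm (u - w) + nrm (w - v).
Proof. by apply: le_trans (nrmD _ _); rewrite addrA subrK. Qed.

Lemma nrmZ (k : R[i]) v : nrm (k *: v) = nrm (k : R[i]^o) * nrm v.
Proof. by apply: complexI; rewrite rmorphM /= !nrmE normrZ. Qed.

Lemma nrmZr (k : R) v : nrm (k%:C *: v) = `|k| * nrm v.
Proof.
apply: complexI; rewrite rmorphM /= !nrmE normrZ normc_def /=.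
by rewrite expr0n addr0 sqrtr_sqr.
Qed.

Lemma nrmDD v : nrm (v + v) = 2 * nrm v.
Proof. by rewrite -mulr2n -scaler_nat -(rmorph_nat (real_complex R)) nrmZr ger0_norm. Qed.

Lemma nrmZi v : nrm ('i *: v) = nrm v.
Proof. by rewrite /nrm normrZ normCi mul1r. Qed.

Lemma eq_of_dist u v : (forall e : R, 0 < e -> nrm (u - v) <= e) -> u = v.
Proof.
move=> uv; apply/eqP; rewrite -subr_eq0; apply/eqP/nrm_le0.
by apply/ler_addgt0Pl => e e0; rewrite addr0; exact: uv.
Qed.

End RealNorm.

Lemma bounded_continuous (R : realType) (V W : normedModType R[i])
    (f : {linear V -> W}) (K : R) :
  (forall v, nrm (f v) <= K * nrm v) -> continuous f.
Proof.
move=> fK; apply/linear_bounded_continuous/linear_boundedP.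
exists `|K|%:C; split; first by rewrite ger0_real// lecR.
move=> r rK v; apply: (@le_trans _ _ (`|K|%:C * `|v|)).
  rewrite -!nrmE -rmorphM lecR; apply: le_trans (fK v) _.
  by rewrite ler_wpM2r ?nrm_ge0 ?ler_norm.
by rewrite ler_wpM2r// ltW.
Qed.

Lemma continuous_bounded (R : realType) (V W : normedModType R[i])
    (f : {linear V -> W}) :
  continuous f -> exists2 K : R, 0 <= K & forall v, nrm (f v) <= K * nrm v.
Proof.
move=> /linear_bounded_continuous/linear_boundedP/pinfty_ex_gt0[r r0 rf].
have r_ge0 := ltW r0.
exists (complex.Re r); first by rewrite -lecR RRe_real ?gtr0_real.
by move=> v; rewrite -lecR rmorphM /= !nrmE RRe_real ?gtr0_real.
Qed.

(** * Filters in terms of real norms, geometric sequences and fixed points *)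

Section Limits.
Context {R : realType}.

Lemma near_nrm (V : normedModType R[i]) (l : V) (F : set_system V) : Filter F ->
  (forall e : R, 0 < e -> F [set v | nrm (l - v) < e]) -> F --> l.
Proof.
move=> FF Fl; apply/cvgrPdist_lt => e e0.
have eE : (complex.Re e)%:C = e by rewrite RRe_real ?gtr0_real.
have e0' : 0 < complex.Re e by rewrite -ltcR eE.
near=> v; rewrite -nrmE -eE ltcR; near: v; exact: Fl.
Unshelve. all: by end_near. Qed.

Lemma cvg_nrm (V : normedModType R[i]) (l : V) (F : set_system V) : Filter F ->
  F --> l -> forall e : R, 0 < e -> F [set v | nrm (l - v) < e].
Proof.
move=> FF /cvgrPdist_lt Fl e e0.
have /Fl : 0 < e%:C by rewrite ltcR.
by apply: filterS => v; rewrite -nrmE ltcR.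
Qed.

Lemma cauchy_nrm (V : normedModType R[i]) (F : set_system V) : ProperFilter F ->
  (cauchy F <-> forall e : R, 0 < e -> exists v, F [set w | nrm (v - w) < e]).
Proof.
move=> FF; split.
  move=> /cauchyP Fc e e0; have /Fc[v Fv] : 0 < e%:C by rewrite ltcR.
  by exists v; apply: filterS Fv => w; rewrite -ball_normE /= -nrmE ltcR.
move=> Fc; apply/cauchyP => e e0.
have eE : (complex.Re e)%:C = e by rewrite RRe_real ?gtr0_real.
have /Fc[v Fv] : 0 < complex.Re e by rewrite -ltcR eE.
by exists v; apply: filterS Fv => w; rewrite -ball_normE /= -nrmE -eE ltcR.
Qed.

Lemma geometric_small (M e : R) : 0 < e -> exists n, M * 2^-1 ^+ n < e.
Proof.
move=> e0; exists (Num.bound (`|M| / e)).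
have := archi_boundP (divr_ge0 (normr_ge0 M) (ltW e0)).
set n := Num.bound _ => Mn.
rewrite exprVn ltr_pdivrMr ?exprn_gt0// mulrC -ltr_pdivrMr//.
apply: le_lt_trans (_ : `|M| / e < _); first by rewrite ler_pM2r ?invr_gt0 ?ler_norm.
by apply: lt_trans Mn _; rewrite -natrX ltr_nat ltn_expl.
Qed.

Lemma geometric_cvg (V : completeNormedModType R[i]) (u : nat -> V) (M : R) :
  (forall n, nrm (u n.+1 - u n) <= M * 2^-1 ^+ n) ->
  exists l, forall n, nrm (l - u n) <= 2 * M * 2^-1 ^+ n.
Proof.
move=> uM.
have h0 n : 0 < 2^-1 ^+ n :> R by rewrite exprn_gt0// invr_gt0.
have M0 : 0 <= M by have := le_trans (nrm_ge0 _) (uM 0%N); rewrite expr0 mulr1.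
(* Subtracting the tail of the geometric series makes the bound inductive in [m]. *)
have uD m n : nrm (u (n + m)%N - u n) <= 2 * M * 2^-1 ^+ n - 2 * M * 2^-1 ^+ (n + m).
  elim: m => [|m IH]; first by rewrite addn0 !subrr nrm0.
  rewrite addnS; apply: le_trans (nrm_dist (u (n + m)%N) _ _) _.
  have := uM (n + m)%N; rewrite exprS; move: IH; lra.
have uD' m n : (n <= m)%N -> nrm (u m - u n) <= 2 * M * 2^-1 ^+ n.
  move=> /subnKC <-; have := uD (m - n)%N n.
  have := mulr_ge0 M0 (ltW (h0 (n + (m - n))%N)); lra.
have /cauchy_cvg : cauchy (u @ \oo).
  apply/cauchy_nrm => e e0; have [n ne] := geometric_small (2 * M) e0.
  exists (u n); exists n => // m /= nm; rewrite nrmBC.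
  exact: le_lt_trans (uD' _ _ nm) ne.
move=> /cvg_ex[l ul]; exists l => n.
apply/ler_addgt0Pl => e e0.
have /cvg_nrm/(_ _ e0)[N _ Nl] := ul.
have := Nl (maxn N n) (leq_maxl _ _); have := uD' _ _ (leq_maxr N n).
have := nrm_dist (u (maxn N n)) l (u n); rewrite /=; lra.
Qed.

(** Banach's fixed point theorem on the closed set [P], with iteration from 0. It produces Cayley
    transforms and square roots inside [A], where no unit is at hand; [P] carries side conditions
    such as self-adjointness to the limit. *)
Lemma contraction_fixpoint (V : completeNormedModType R[i]) (P : V -> Prop)
    (T : V -> V) :
  P 0 -> (forall x, (forall e : R, 0 < e -> exists2 y, P y & nrm (x - y) <= e) -> P x) ->
  (forall x, P x -> P (T x)) ->
  (forall x y, P x -> P y -> nrm (T x - T y) <= 2^-1 * nrm (x - y)) ->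
  exists2 x, P x & T x = x.
Proof.
move=> P0 Pcl PT T2; pose u n := iter n T 0.
have Pu n : P (u n) by elim: n => //= n; exact: PT.
have uu n : nrm (u n.+1 - u n) <= nrm (u 1%N - u 0%N) * 2^-1 ^+ n.
  elim: n => [|n IH]; first by rewrite mulr1.
  by have := T2 _ _ (Pu n.+1) (Pu n); rewrite exprS; move: IH => /=; lra.
have [l ul] := geometric_cvg uu; set M := nrm (u 1%N - u 0%N) in uu ul.
have Pl : P l.
  apply: Pcl => e /(geometric_small (2 * M))[n ne].
  by exists (u n) => //; apply: le_trans (ul n) (ltW ne).
exists l => //; apply: eq_of_dist => e /(geometric_small (2 * M))[n ne].
have := T2 _ _ Pl (Pu n); have := ul n; have := ul n.+1.
have := nrm_dist (u n.+1) (T l) l; rewrite (nrmBC l (u n.+1)) exprS /=; lra.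
Qed.

End Limits.

(** * Elementary identities in normed algebras *)

Section NormedAlgTheory.
Context {R : realType} {A : normedAlgType R}.
Implicit Types a b c : A.

Lemma amul0r a : 0 ** a = 0 :> A.
Proof. by rewrite -(scale0r (0 : A)) amulZl !scale0r. Qed.

Lemma amulr0 a : a ** 0 = 0 :> A.
Proof. by rewrite -(scale0r (0 : A)) amulZr !scale0r. Qed.

Lemma amulNr a b : (- a) ** b = - (a ** b).
Proof. by rewrite -scaleN1r amulZl scaleN1r. Qed.

Lemma amulrN a b : a ** (- b) = - (a ** b).
Proof. by rewrite -scaleN1r amulZr scaleN1r. Qed.

Lemma amulBl a b c : (a - b) ** c = a ** c - b ** c.
Proof. by rewrite amulDl amulNr. Qed.

Lemma amulBr a b c : a ** (b - c) = a ** b - a ** c.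
Proof. by rewrite amulDr amulrN. Qed.

Lemma nrmM a b : nrm (a ** b) <= nrm a * nrm b.
Proof. by rewrite -lecR rmorphM /= !nrmE ler_norm_amul. Qed.

End NormedAlgTheory.

(** * The C*-identity, Cayley transforms, real and imaginary parts *)

Section CStarTheory.
Context {R : realType} {A : cstarAlgType R}.
Implicit Types a b c h q t : A.

Lemma star0 : star (0 : A) = 0.
Proof. by apply: (addrI (star 0)); rewrite -starD !addr0. Qed.

Lemma starN a : star (- a) = - star a.
Proof. by apply/eqP; rewrite -addr_eq0 -starD addNr star0. Qed.

Lemma starB a b : star (a - b) = star a - star b.
Proof. by rewrite starD starN. Qed.

Lemma starZr (k : R) a : star (k%:C *: a) = k%:C *: star a.
Proof. by rewrite starZ conj_Creal ?complex_real. Qed.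

Lemma starZi a : star ('i *: a) = - ('i *: star a).
Proof. by rewrite starZ conjCi scaleNr. Qed.

Lemma nrm_starM a : nrm (star a ** a) = nrm a ^+ 2.
Proof. by apply: complexI; rewrite rmorphXn /= !nrmE cstar_norm. Qed.

Lemma nrm_star a : nrm (star a) = nrm a.
Proof.
have le_star b : nrm b <= nrm (star b).
  have := nrmM (star b) b; rewrite nrm_starM expr2.
  have [->|b0] := eqVneq (nrm b) 0; first by rewrite nrm_ge0.
  by rewrite ler_pM2r // lt_def b0 nrm_ge0.
by apply/eqP; rewrite eq_le le_star -{2}[a]starK le_star.
Qed.

(* [1 - t] is an isometry of the unitization of [A]. *)
Lemma nrm_isometry t c : star t ** t = t + star t -> nrm (c - t ** c) = nrm c.
Proof.
move=> tt; apply/eqP.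
rewrite -(@eqrXn2 _ 2%N) ?nrm_ge0// -!nrm_starM; apply/eqP; congr nrm.
rewrite starB starM amulBr !amulBl -!amulA [star t ** (t ** _)]amulA tt amulDl amulDr.
by rewrite opprB (addrC (star c ** (t ** c))) addrK subrK.
Qed.

(** The equation expresses [q = a (a + i)^-1] without a unit. Since [1 - 2q] preserves the norm of
    [star q], the norm of [2 q (star q)] is at most [2 |q|], while the C*-identity makes it
    [2 |q|^2]. *)
Lemma cayley_bound a q : star a = a -> a ** q + 'i *: q = a -> nrm q <= 1.
Proof.
move=> sa aq.
have iq : 'i *: q = a - a ** q by rewrite -{1}aq addrC addKr.
have isq : 'i *: star q = star q ** a - a.
  by rewrite -[X in _ - X]sa -{2}aq starD starM sa starZi opprB addrC subrK.
(* After multiplication by ['i], both sides equal [star q ** a - a ** q]. *)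
have qq : star q ** q + star q ** q = q + star q.
  apply: (scalerI (neq0Ci _)); rewrite !scalerDr -{1}amulZr -amulZl iq isq.
  rewrite amulBr amulBl amulA. by rewrite addrA subrK [RHS]addrC addrA subrK.
have tt : star (q + q) ** (q + q) = q + q + star (q + q).
  by rewrite starD amulDl !amulDr qq addrACA.
have qE := nrm_isometry (star q) tt.
have : nrm (q ** star q + q ** star q) <= nrm (star q) + nrm (star q).
  rewrite -{2}qE -(amulDl q) addrC.
  by apply: le_trans (nrmB _ _); rewrite opprB addrC subrK.
have := nrm_starM (star q); rewrite starK nrmDD nrm_star expr2 => ->.
have [//|q1] := leP (nrm q) 1; nra.
Qed.

(** Solving for the second term gives [q = -i (a - a q)], a fixed-point equation with Lipschitz
    constant at most [|a|]. *)
Lemma cayley_exists_small a : nrm a <= 2^-1 -> exists q, a ** q + 'i *: q = a.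
Proof.
move=> a1; pose T q := (- 'i) *: (a - a ** q).
have [//|//||q _ Tq] := @contraction_fixpoint R A (fun=> True) T I.
  move=> x y _ _; rewrite /T -scalerBr scaleNr nrmN nrmZi opprD opprK addrACA subrr add0r.
  rewrite addrC -amulBr nrmBC; apply: le_trans (nrmM _ _) _.
  by rewrite ler_wpM2r ?nrm_ge0.
exists q; rewrite -{2}Tq /T scalerA mulrN -expr2 sqrCi opprK scale1r.
by rewrite addrC subrK.
Qed.

(* With [q = a (a + i)^-1], this is the Neumann series step from the
   invertibility of [a + i] to that of [a + 2i/3], the bound [|q| <= 1] making
   it possible to iterate with a constant ratio. *)
Lemma cayley_step a q : star a = a -> a ** q + 'i *: q = a ->
  exists q', (a + (2^-1)%:C *: a) ** q' + 'i *: q' = a + (2^-1)%:C *: a.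
Proof.
move=> sa aq; have q1 := cayley_bound sa aq.
(* This is [(a + i) x = a + (a - a x) / 2], formally multiplied by [(a + i)^-1]. *)
pose T x := q + (2^-1)%:C *: (q - q ** x).
have [//|//||x _ Tx] := @contraction_fixpoint R A (fun=> True) T I.
  move=> x y _ _; rewrite /T opprD addrACA subrr add0r -scalerBr.
  rewrite opprB addrC addrA subrK nrmZr ger0_norm ?invr_ge0//.
  rewrite ler_pM2l ?invr_gt0// nrmBC -amulBr.
  by apply: le_trans (nrmM _ _) _; rewrite ler_piMl ?nrm_ge0.
have aq' : a ** q = a - 'i *: q by rewrite -{2}aq addrK.
have ax : a ** x = a - 'i *: q + (2^-1)%:C *: (a - 'i *: q - (a ** x - 'i *: (q ** x))).
  by rewrite -{1}Tx /T amulDr amulZr amulBr amulA aq' amulBl amulZl.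
have xE : 'i *: x = 'i *: q + (2^-1)%:C *: ('i *: q - 'i *: (q ** x)).
  by rewrite -{1}Tx /T scalerDr scalerA mulrC -scalerA scalerBr.
exists x; rewrite amulDl amulZl {1}ax xE.
rewrite addrAC addrACA subrK -addrA -!scalerDr.
by rewrite opprB [_ + ('i *: q - _)]addrAC !addrA !subrK.
Qed.

(** Induction on the number of halvings that bring [|a|] below 1/2, where the small case applies. *)
Lemma cayley_exists a : star a = a -> exists q, a ** q + 'i *: q = a.
Proof.
move=> sa; have h0 : 0 < 2^-1 :> R by rewrite invr_gt0.
have [n] := geometric_small (nrm a) h0.
elim: n a sa => [|n IH] a sa an.
  by apply: cayley_exists_small; rewrite -[nrm a]mulr1 ltW.
(* Two uses of [cayley_step] scale by [(3/2)^2 = 9/4]; as [4/9 <= 1/2], they undo one halving, which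
   a single step with 2/3 would not. *)
pose b := (4 / 9)%:C *: a.
have sb : star b = b by rewrite starZr sa.
have [q bq] : exists q, b ** q + 'i *: q = b.
  apply: IH => //; rewrite nrmZr ger0_norm ?divr_ge0//.
  move: an; rewrite exprS; have := mulr_ge0 (nrm_ge0 a) (exprn_ge0 n (ltW h0)).
  lra.
have sc : star (b + (2^-1)%:C *: b) = b + (2^-1)%:C *: b by rewrite starD sb starZr sb.
have [r br] := cayley_step sb bq; have [t] := cayley_step sc br.
suff -> : b + (2^-1)%:C *: b + (2^-1)%:C *: (b + (2^-1)%:C *: b) = a by exists t.
rewrite /b scalerDr !scalerA -!scalerDl -!rmorphM -!rmorphD /=.
by rewrite (_ : _ + _ = 1) ?scale1r//; field.
Qed.

Lemma scaled_cayley a (l : R) : star a = a -> 0 < l ->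
  exists2 q, a ** q + (l%:C * 'i) *: q = a & nrm q <= 1.
Proof.
move=> sa l0; pose b := l^-1%:C *: a.
have sb : star b = b by rewrite starZr sa.
have [q bq] := cayley_exists sb; exists q; last exact: cayley_bound bq.
have ab : a = l%:C *: b.
  by rewrite scalerA -rmorphM /= divff ?gt_eqF// scale1r.
by rewrite {1}ab amulZl -scalerA -scalerDr bq -ab.
Qed.

Definition repart a := (2^-1)%:C *: (a + star a).
Definition impart a := repart (- ('i *: a)).

Lemma repart_sa a : star (repart a) = repart a.
Proof. by rewrite starZr starD starK addrC. Qed.

Lemma impart_sa a : star (impart a) = impart a.
Proof. exact: repart_sa. Qed.

Lemma nrm_repart a : nrm (repart a) <= nrm a.
Proof.
rewrite nrmZr ger0_norm ?invr_ge0//.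
have := nrmD a (star a); rewrite nrm_star; lra.
Qed.

Lemma nrm_impart a : nrm (impart a) <= nrm a.
Proof. by apply: le_trans (nrm_repart _) _; rewrite nrmN nrmZi. Qed.

Lemma cartesian a : a = repart a + 'i *: impart a.
Proof.
have -> : 'i *: impart a = (2^-1)%:C *: (a - star a).
  rewrite /impart /repart starN starZi opprK scalerA mulrC -scalerA; congr (_ *: _).
  by rewrite scalerDr scalerN !scalerA -expr2 sqrCi !scaleN1r opprK.
rewrite -scalerDr addrACA subrr addr0 scalerDr -scalerDl -rmorphD /=.
by rewrite (_ : 2^-1 + 2^-1 = 1 :> R) ?scale1r//; field.
Qed.

End CStarTheory.

(** * Boundedness and bounded lifts for star-homomorphisms *)

(** Successive approximation as in the open mapping theorem: the residuals at least halve, and the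
    approximate preimages form a series in the complete space [V], bounded by
    [C (1 + 1/2 + 1/4 + ...)]. The set [S] allows targets that are only known to be adherent to the
    range. *)
Lemma exact_lift (R : realType) (V : completeNormedModType R[i])
    (W : normedModType R[i]) (T : {linear V -> W}) (S : W -> Prop) (K C : R) :
  0 <= C -> (forall v, nrm (T v) <= K * nrm v) ->
  (forall w v, S w -> S (w - T v)) ->
  (forall w, S w -> exists v, nrm v <= C * nrm w /\ nrm (w - T v) <= 2^-1 * nrm w) ->
  forall w, S w -> exists2 v, T v = w & nrm v <= 2 * C * nrm w.
Proof.
move=> C0 TK ST SC w Sw.
have /choice[f fP] : forall x, exists v,
    S x -> nrm v <= C * nrm x /\ nrm (x - T v) <= 2^-1 * nrm x.
  by move=> x; have [/SC[v vP]|nS] := pselect (S x); [exists v | exists 0].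
pose r n := iter n (fun x => x - T (f x)) w.
have Sr n : S (r n) by elim: n => //= n; exact: ST.
have rn n : nrm (r n) <= nrm w * 2^-1 ^+ n.
  elim: n => [|n IH]; first by rewrite mulr1.
  by have [_] := fP _ (Sr n); rewrite exprS /=; lra.
pose u n := \sum_(i < n) f (r i).
have Tu n : T (u n) = w - r n.
  elim: n => [|n IH]; first by rewrite /u big_ord0 linear0 subrr.
  by rewrite /u big_ord_recr linearD /= -/(u n) IH opprB addrA addrAC.
have [|l lu] := @geometric_cvg _ _ u (C * nrm w).
  move=> n; rewrite /u big_ord_recr /= addrC addrK.
  have [+ _] := fP _ (Sr n) => /le_trans; apply.
  by rewrite -mulrA ler_wpM2l.
exists l; last by have := lu 0%N; rewrite /u big_ord0 subr0 mulr1 mulrA.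
apply: eq_of_dist => e /(geometric_small (`|K| * (2 * (C * nrm w)) + nrm w))[n ne].
have Tl : nrm (T l - T (u n)) <= `|K| * nrm (l - u n).
  by rewrite -linearB; apply: le_trans (TK _) _; rewrite ler_wpM2r ?nrm_ge0 ?ler_norm.
have := nrm_dist (T (u n)) (T l) w; rewrite {2}Tu addrAC subrr add0r nrmN.
have := rn n; have := ler_wpM2l (normr_ge0 K) (lu n); rewrite mulrDl mulrA in ne *; lra.
Qed.

Section StarHomTheory.
Context {R : realType} {A : cstarAlgType R} (s : starHom A).
Implicit Types a b c h q t : A.

Lemma starhomZ (k : R[i]) a : s (k *: a) = k *: s a.
Proof. exact: linearZZ. Qed.

(* [1 - k] is a square root of [1 - h^2], so that [1 - k - i h] is unitary. *)
Lemma selfadjoint_sqrt h : star h = h -> nrm h <= 2^-1 ->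
  exists k, [/\ star k = k, k ** h = h ** k & h ** h + k ** k = k + k].
Proof.
move=> sh h1.
pose P k := [/\ star k = k, k ** h = h ** k & nrm k <= 2^-1].
(* The equation [h^2 + k^2 = 2 k] as a fixed-point problem. On the ball of radius 1/2,
   [k |-> k^2 / 2] has Lipschitz constant 1/2, and [T] maps that ball into itself. *)
pose T k := (2^-1)%:C *: (h ** h + k ** k).
have [||||k [sk kh _] Tk] := @contraction_fixpoint R A P T.
- by split; rewrite ?star0 ?amul0r ?amulr0 ?nrm0 ?invr_ge0.
- move=> x Px; split.
  + apply: eq_of_dist => e e0; have [y [sy _ _] xy] := Px _ (divr_gt0 e0 (ltr0Sn R 1)).
    apply: le_trans (nrm_dist y _ _) _; rewrite -{1}sy -starB nrm_star (nrmBC y).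
    lra.
  + apply: eq_of_dist => e e0; have [y [_ yh _] xy] := Px _ e0.
    have -> : x ** h - h ** x = (x - y) ** h - h ** (x - y).
      by rewrite amulBl amulBr yh opprB addrA subrK.
    have := nrmB ((x - y) ** h) (h ** (x - y)).
    have := nrmM (x - y) h; have := nrmM h (x - y); have := nrm_ge0 (x - y); nra.
  + apply/ler_addgt0Pl => e e0; have [y [_ _ y1] xy] := Px _ e0.
    have := nrmD (x - y) y; rewrite subrK; lra.
- move=> k [sk kh k1]; split; rewrite /T.
  + by rewrite starZr starD !starM sh sk.
  + by rewrite amulZl amulZr amulDl amulDr -!amulA kh !amulA kh.
  + rewrite nrmZr ger0_norm ?invr_ge0//.
    have := nrmD (h ** h) (k ** k); have := nrmM h h; have := nrmM k k.
    have := nrm_ge0 h; have := nrm_ge0 k; nra.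
- move=> x y [_ _ x1] [_ _ y1].
  rewrite /T -scalerBr nrmZr ger0_norm ?invr_ge0// ler_pM2l ?invr_gt0//.
  rewrite opprD addrACA subrr add0r.
  have -> : x ** x - y ** y = x ** (x - y) + (x - y) ** y.
    by rewrite amulBr amulBl addrA subrK.
  have := nrmD (x ** (x - y)) ((x - y) ** y).
  have := nrmM x (x - y); have := nrmM (x - y) y; have := nrm_ge0 (x - y); nra.
- exists k; split=> //.
  rewrite -{3 4}Tk /T -scalerDl -rmorphD /= (_ : 2^-1 + 2^-1 = 1) ?scale1r//; lra.
Qed.

(** With [t = k + i h], the element [1 - t] is unitary, so both [1 - s t] and [1 - s (star t)]
    preserve the norm of [s h]. Applied to [s h] they differ by [2 i (s h)^2], whence
    [2 |s h|^2 <= 2 |s h|]. *)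
Lemma starhom_bounded_sa h : star h = h -> nrm h <= 2^-1 -> nrm (s h) <= 1.
Proof.
move=> sh h1; have [k [sk kh hk]] := selfadjoint_sqrt sh h1.
pose t := k + 'i *: h.
have st : star t = k - 'i *: h by rewrite starD starZi sk sh.
have tt : t + star t = k + k by rewrite st addrACA subrr addr0.
have ii : 'i *: ('i *: (h ** h)) = - (h ** h).
  by rewrite scalerA -expr2 sqrCi scaleN1r.
have stt : star t ** t = t + star t.
  rewrite tt st amulBl !amulDr !(amulZl, amulZr) kh ii.
  by rewrite opprD opprK addrA addrK addrC -hk.
have tst : t ** star t = t + star t.
  rewrite tt st amulDl !amulBr !(amulZl, amulZr) kh ii opprK.
  by rewrite addrA subrK addrC -hk.
have iso : nrm (s h - s t ** s h) = nrm (s h).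
  by apply: nrm_isometry; rewrite -starhomS -starhomM stt linearD.
have iso' : nrm (s h - s (star t) ** s h) = nrm (s h).
  by apply: nrm_isometry; rewrite -starhomS starK -starhomM tst addrC linearD.
have := nrmB (s h - s (star t) ** s h) (s h - s t ** s h).
rewrite iso iso' opprB addrC addrA subrK st linearB linearD /= !starhomZ.
rewrite amulBl amulDl opprB addrC addrA subrK amulZl nrmDD nrmZi.
rewrite -{1}sh starhomS nrm_starM.
have [//|] := leP (nrm (s h)) 1; nra.
Qed.

Lemma starhom_repart a : s (repart a) = repart (s a).
Proof. by rewrite starhomZ linearD starhomS. Qed.

Lemma starhom_impart a : s (impart a) = impart (s a).
Proof. by rewrite starhom_repart linearN /= starhomZ. Qed.

Lemma starhom_bounded a : nrm (s a) <= 4 * nrm a.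
Proof.
(* Rescaling [h] to norm 1/2 costs a factor 2; the sum of real and imaginary parts costs another. *)
have bound_sa h : star h = h -> nrm (s h) <= 2 * nrm h.
  move=> sh; have [h0|h0] := eqVneq (nrm h) 0.
    by rewrite (nrm_eq0 h0) linear0 !nrm0 mulr0.
  have hp : 0 < nrm h by rewrite lt_def h0 nrm_ge0.
  pose l := (2 * nrm h)^-1; have l0 : 0 < l by rewrite invr_gt0 mulr_gt0.
  have := @starhom_bounded_sa (l%:C *: h).
  have lh : l * nrm h = 2^-1 by rewrite /l invfM -mulrA mulVf// mulr1.
  rewrite starZr sh starhomZ !nrmZr !gtr0_norm// lh => /(_ erefl (lexx _)).
  by rewrite -ler_pdivlMl// invrK mulr1.
rewrite {1}(cartesian a) linearD /= (starhomZ 'i).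
apply: le_trans (nrmD _ _) _; rewrite nrmZi.
have := bound_sa _ (repart_sa a); have := bound_sa _ (impart_sa a).
have := nrm_repart a; have := nrm_impart a; lra.
Qed.

(** Take [a' = i l q] for the Cayley transform [q] with parameter [l = 9 |s a|]. Then
    [s a - s a' = s a ** s q], so [9 |s a| |s q| = |s a'| <= |s a| + |s a| |s q|], which forces
    [|s q| <= 1/8]. *)
Lemma approx_lift_sa a : star a = a ->
  exists a', nrm a' <= 9 * nrm (s a) /\ nrm (s a - s a') <= 8^-1 * nrm (s a).
Proof.
move=> sa; have [b0|b0] := eqVneq (nrm (s a)) 0.
  by exists 0; rewrite linear0 subr0 b0 nrm0 !mulr0.
have bp : 0 < nrm (s a) by rewrite lt_def b0 nrm_ge0.
have [q aq q1] := scaled_cayley sa (mulr_gt0 (ltr0Sn R 8) bp).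
exists (((9 * nrm (s a))%:C * 'i) *: q); split.
  rewrite -scalerA nrmZr nrmZi gtr0_norm ?mulr_gt0//.
  by rewrite ler_piMr ?mulr_ge0 ?nrm_ge0.
have saq : s a ** s q = s a - s (((9 * nrm (s a))%:C * 'i) *: q).
  by rewrite -{2}aq linearD /= starhomM addrK.
rewrite -saq; apply: le_trans (nrmM _ _) _; rewrite mulrC ler_pM2r//.
have : nrm (s (((9 * nrm (s a))%:C * 'i) *: q)) <= nrm (s a) + nrm (s a) * nrm (s q).
  apply: le_trans (_ : nrm (s a) + nrm (s a ** s q) <= _); last by rewrite lerD2l nrmM.
  by rewrite saq; apply: le_trans (nrmB _ _); rewrite opprB addrC subrK.
rewrite -scalerA !starhomZ nrmZr nrmZi gtr0_norm ?mulr_gt0//.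
nra.
Qed.

Lemma approx_lift a :
  exists a', nrm a' <= 18 * nrm (s a) /\ nrm (s a - s a') <= 4^-1 * nrm (s a).
Proof.
have [h [h1 h2]] := approx_lift_sa (repart_sa a).
have [k [k1 k2]] := approx_lift_sa (impart_sa a).
rewrite starhom_repart in h1 h2; rewrite starhom_impart in k1 k2.
have := nrm_repart (s a); have := nrm_impart (s a).
exists (h + 'i *: k); split.
  have := nrmD h ('i *: k); rewrite nrmZi; lra.
rewrite {1}(cartesian (s a)) linearD /= (starhomZ 'i) opprD addrACA -scalerBr.
apply: le_trans (nrmD _ _) _; rewrite nrmZi; lra.
Qed.

Definition adherent_range (c : A) : Prop :=
  forall e : R, 0 < e -> exists a, nrm (c - s a) <= e.

(** Covering adherent points serves two purposes: bounded lifts of elements of the range, and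
    closedness of the range. *)
Lemma lift_bounded c : adherent_range c ->
  exists2 a, s a = c & nrm a <= 42 * nrm c.
Proof.
rewrite (_ : 42 = 2 * 21); last by rewrite -natrM.
apply: (@exact_lift _ _ _ s adherent_range 4) => [//|a|c' a cc e e0|{}c cc].
- exact: starhom_bounded.
- have [b cb] := cc _ e0; exists (b - a).
  by rewrite linearB opprB addrA subrK.
- have [c0|c0] := eqVneq (nrm c) 0.
    by exists 0; rewrite linear0 subr0 c0 nrm0 !mulr0.
  have cp : 0 < nrm c by rewrite lt_def c0 nrm_ge0.
  (* With [|c - s a| <= |c| / 8] one has [|s a| <= 9/8 |c|], so the lift has norm at most
     [18 * 9/8 |c| <= 21 |c|] and the error is at most [(1/8 + 9/32) |c| <= |c| / 2]. *)
  have [a ca] := cc _ (divr_gt0 cp (ltr0Sn R 7)).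
  have [a' [a1 a2]] := approx_lift a.
  have := nrm_dist c (s a) 0; rewrite !subr0 nrmBC => sac.
  exists a'; split; first by lra.
  apply: le_trans (nrm_dist (s a) _ _) _; lra.
Qed.

End StarHomTheory.

(** * Bimodule identities and skew-inner derivations *)

Definition to_linear (K : pzRingType) (U V : lmodType K) (f : U -> V)
    (lf : linear f) : {linear U -> V} :=
  HB.pack f (GRing.isLinear.Build _ _ _ _ f lf).

Section Bimodules.
Context {R : realType} {B : normedAlgType R} {X : normedModType R[i]}.
Variable M : bimodule B X.

Lemma lact0l x : lact M 0 x = 0.
Proof. exact: (linear0 (to_linear (lact_linearl M x))). Qed.

Lemma lactDr b x y : lact M b (x + y) = lact M b x + lact M b y.
Proof. exact: (linearD (to_linear (lact_linearr M b))). Qed.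

Lemma lactBr b x y : lact M b (x - y) = lact M b x - lact M b y.
Proof. exact: (linearB (to_linear (lact_linearr M b))). Qed.

Lemma ract0r x : ract M x 0 = 0.
Proof. exact: (linear0 (to_linear (ract_linearr M x))). Qed.

Lemma ractDl b x y : ract M (x + y) b = ract M x b + ract M y b.
Proof. exact: (linearD (to_linear (ract_linearl M b))). Qed.

Lemma ractBl b x y : ract M (x - y) b = ract M x b - ract M y b.
Proof. exact: (linearB (to_linear (ract_linearl M b))). Qed.

(** Comparing [x.ab + ab.x] with [(x.a + a.x).b + a.(x.b + b.x)] leaves [2 a.x.b = 0]. *)
Lemma skew_vanish (d : {linear B -> X}) x : derivation idfun M d ->
  (forall b, d b = ract M x b + lact M b x) ->
  forall a b, lact M a (ract M x b) = 0.
Proof.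
move=> dd dx a b; have := dd a b.
rewrite !dx ractA lactA lactDr ractDl /= lractA => /eqP.
rewrite -addrA (inj_eq (addrI _)) addrA -{1}[lact M a (lact M b x)]add0r.
rewrite (inj_eq (addIr _)) eq_sym -mulr2n -scaler_nat scaler_eq0 pnatr_eq0 /=.
by move=> /eqP.
Qed.

Lemma skew_to_inner (d : {linear B -> X}) x w :
  (forall b, d b = ract M x b + lact M b x) ->
  (forall b, ract M w b = 0) -> (forall b, lact M b w = lact M b x) ->
  inner idfun M d.
Proof.
move=> dx w0 wx; exists (x - (w + w)) => b.
rewrite dx ractBl ractDl !w0 addr0 subr0 lactBr lactDr wx.
by rewrite opprB addrK.
Qed.

End Bimodules.

(** * Transfer of derivations between the algebra and its image *)

Section ImageOfStarHom.
Context {R : realType} {A : cstarAlgType R} (s : starHom A).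
Local Notation B := (image_alg (starhom_subalg s)).
Local Notation cs := (corestrict (starhom_subalg s)).

Lemma corestrict_linear : linear cs.
Proof. by move=> k a b; apply: val_inj; rewrite /= linearP. Qed.

Lemma corestrictM a b : cs (a ** b) = cs a ** cs b.
Proof. by apply: val_inj; rewrite /= starhomM. Qed.

Lemma corestrict_lift (b : B) : exists2 a, cs a = b & nrm a <= 42 * nrm b.
Proof.
case: b => b bP; have /asboolP[a0 _ a0b] := bP.
have [|a ab aP] := @lift_bounded _ _ s b.
  by move=> e e0; exists a0; rewrite -a0b subrr nrm0 ltW.
by exists a => //; apply: val_inj.
Qed.

Section Factor.
Context {X : normedModType R[i]} (M : bimodule B X).

(* If [s a = 0] and [a = a q + i e q] then [s q = 0], so [a q] is a product of
   elements of the kernel and [D] sees only the small remainder. *)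
Lemma derivation_ker (D : {linear A -> X}) : continuous D ->
  derivation cs M D -> forall a, s a = 0 -> D a = 0.
Proof.
move=> /continuous_bounded[K K0 DK] DD.
have cs0 a : s a = 0 -> cs a = 0 by move=> sa; apply: val_inj.
have ker_sa a : star a = a -> s a = 0 -> D a = 0.
  move=> sa s0; apply: eq_of_dist => e e0; rewrite subr0.
  (* With this parameter [D a = i l D q] has norm at most [e K / (K + 1)]; the added 1 covers
     [K = 0]. *)
  have l0 : 0 < e / (K + 1) by rewrite divr_gt0// ltr_wpDl.
  have [q aq q1] := scaled_cayley sa l0.
  have sq : s q = 0.
    have : s (((e / (K + 1))%:C * 'i) *: q) = 0.
      by rewrite -[RHS]s0 -{1}aq linearD /= starhomM s0 amul0r add0r.
    rewrite starhomZ => /eqP; rewrite scaler_eq0 mulf_eq0 (negbTE (neq0Ci _)) orbF.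
    by rewrite fmorph_eq0 gt_eqF// => /eqP.
  rewrite -aq linearD DD !cs0// ract0r lact0l !add0r -scalerA linearZZ linearZZ.
  rewrite nrmZr nrmZi gtr0_norm// mulrAC ler_pdivrMr ?ltr_wpDl//.
  by rewrite ler_pM2l//; have := DK q; have := nrm_ge0 q; nra.
move=> a s0; rewrite (cartesian a) linearD (linearZZ D 'i).
rewrite !ker_sa ?repart_sa ?impart_sa ?scaler0 ?addr0//.
  by rewrite starhom_impart s0 /impart /repart scaler0 oppr0 star0 addr0 scaler0.
by rewrite starhom_repart s0 /repart star0 addr0 scaler0.
Qed.

(** Choose arbitrary bounded lifts [f]. Vanishing of [D] on the kernel makes [D (f b)] independent
    of the choice, hence linear in [b]; the bound on lifts gives continuity. *)
Lemma derivation_factor (D : {linear A -> X}) : continuous D ->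
  derivation cs M D -> exists d : {linear B -> X},
    [/\ continuous d, derivation idfun M d & forall a, D a = d (cs a)].
Proof.
move=> cD DD; have [K K0 DK] := continuous_bounded cD.
have /choice[f fP] : forall b : B, exists a, cs a = b /\ nrm a <= 42 * nrm b.
  by move=> b; have [a ? ?] := corestrict_lift b; exists a.
have Df a : D a = D (f (cs a)).
  apply/eqP; rewrite -subr_eq0 -linearB; apply/eqP/(derivation_ker cD DD).
  have [fa _] := fP (cs a); have /= sfa := congr1 val fa.
  by rewrite linearB /= sfa subrr.
have ld : linear (fun b => D (f b)).
  move=> k b c; have [fb _] := fP b; have [fc _] := fP c.
  by rewrite -{1}fb -{1}fc -corestrict_linear -Df linearP.
exists (to_linear ld); split => //.
  apply: (@bounded_continuous _ _ _ _ (K * 42)) => b /=.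
  apply: le_trans (DK _) _; rewrite -mulrA ler_wpM2l//.
  by have [] := fP b.
move=> b c /=; have [fb _] := fP b; have [fc _] := fP c.
by rewrite -{1}fb -{1}fc -corestrictM -Df DD fb fc.
Qed.

Lemma derivation_lift (d : {linear B -> X}) : continuous d ->
  derivation idfun M d -> exists D : {linear A -> X},
    [/\ continuous D, derivation cs M D & forall a, D a = d (cs a)].
Proof.
move=> /continuous_bounded[K K0 dK] dd.
have lD : linear (fun a => d (cs a)).
  by move=> k a b; rewrite corestrict_linear linearP.
exists (to_linear lD); split => //.
  apply: (@bounded_continuous _ _ _ _ (K * 4)) => a /=.
  apply: le_trans (dK _) _; rewrite -mulrA ler_wpM2l//.
  exact: starhom_bounded.
by move=> a b /=; rewrite corestrictM dd.
Qed.

End Factor.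

End ImageOfStarHom.

(** * Completeness of dual spaces *)

Section DualComplete.
Context {R : realType}.

Lemma real_cauchy_lim T (F : set_system T) (FF : ProperFilter F) (g : T -> R) :
  (forall e, 0 < e -> exists x, F [set t | `|x - g t| < e]) ->
  exists l, forall e, 0 < e -> F [set t | `|l - g t| < e].
Proof.
move=> Fg; have /cauchy_cvg/cvg_ex[l gl] : cauchy (g @ F : set_system R^o).
  apply/cauchyP => e /Fg[x Fx]; exists x.
  by rewrite -ball_normE; exact: Fx.
by exists l => e e0; move/cvgrPdist_lt : gl; exact.
Qed.

Lemma nrm_complex_le (z : R[i]) :
  [/\ `|complex.Re z| <= nrm (z : R[i]^o), `|complex.Im z| <= nrm (z : R[i]^o)
    & nrm (z : R[i]^o) <= `|complex.Re z| + `|complex.Im z|].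
Proof.
have le_re (y : R[i]) : `|complex.Re y| <= nrm (y : R[i]^o).
  by rewrite -lecR nrmE; exact: normc_ge_Re.
split=> //.
  have := le_re ('i * z); rewrite (nrmZi (z : R[i]^o)).
  by case: z => a b; rewrite [complex.Re _]/= mul0r mul1r sub0r normrN.
have zE : (z : R[i]^o) = (complex.Re z)%:C *: 1 + (complex.Im z)%:C *: ('i *: 1).
  case: z => a b; apply/eqP; rewrite eq_complex.
  by apply/andP; split; apply/eqP => /=; ring.
have n1 : nrm (1 : R[i]^o) = 1 by rewrite /nrm normr1.
by rewrite {1}zE; apply: le_trans (nrmD _ _) _; rewrite !nrmZr nrmZi n1 !mulr1.
Qed.

Lemma complex_cauchy_lim T (F : set_system T) (FF : ProperFilter F)
    (g : T -> R[i]^o) :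
  (forall e : R, 0 < e -> exists x, F [set t | nrm (x - g t) < e]) ->
  exists l, forall e : R, 0 < e -> F [set t | nrm (l - g t) < e].
Proof.
move=> Fg.
have [|l lP] := @real_cauchy_lim _ F _ (fun t => complex.Re (g t)).
  move=> e /Fg[x Fx]; exists (complex.Re x); apply: filterS Fx => t /=.
  by apply: le_lt_trans; rewrite -raddfB; have [] := nrm_complex_le (x - g t).
have [|m mP] := @real_cauchy_lim _ F _ (fun t => complex.Im (g t)).
  move=> e /Fg[x Fx]; exists (complex.Im x); apply: filterS Fx => t /=.
  by apply: le_lt_trans; rewrite -raddfB; have [] := nrm_complex_le (x - g t).
exists (l +i* m) => e e0.
have e2 : 0 < e / 2 by rewrite divr_gt0.
apply: filterS2 (lP _ e2) (mP _ e2) => t /=.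
have [_ _] := nrm_complex_le ((l +i* m) - g t); rewrite !raddfB /=; lra.
Qed.

Context {Y : normedModType R[i]}.

Lemma nrm_dual (f : dual Y) y : nrm (f y) <= nrm f * nrm y.
Proof. by rewrite -lecR rmorphM /= !nrmE; exact: ler_dual_norm. Qed.

Lemma nrm_dual_le (f : dual Y) (M : R) :
  0 <= M -> (forall y, nrm (f y) <= M * nrm y) -> nrm f <= M.
Proof.
move=> M0 fM; apply: dual_norm_le => y; rewrite -!nrmE !lecR => y1.
by apply: le_trans (fM y) _; rewrite ler_piMr.
Qed.

Lemma bounded_dual (g : Y -> R[i]^o) (M : R) :
  linear g -> (forall y, nrm (g y) <= M * nrm y) -> exists f : dual Y, f =1 g.
Proof.
move=> lg gM; have gP : g \in dual_pred Y.
  by apply: (@bounded_dual_pred _ _ _ M%:C) => // y; rewrite -!nrmE -rmorphM lecR.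
by exists (Dual gP).
Qed.

(** This lets [dual B] serve as the predual module when amenability is applied to a derivation into
    the bidual of [B]. The limit is taken pointwise. *)
Lemma dual_cauchy_cvg (F : set_system (dual Y)) :
  ProperFilter F -> cauchy F -> cvg F.
Proof.
move=> FF /cauchy_nrm Fc.
have /choice[l lP] : forall y, exists z : R[i]^o, forall e : R, 0 < e ->
    F [set f : dual Y | nrm (z - f y) < e].
  move=> y; apply: complex_cauchy_lim => e e0.
  have y1 : 0 < nrm y + 1 by rewrite ltr_wpDl ?nrm_ge0.
  have [f Ff] := Fc _ (divr_gt0 e0 y1); exists (f y); apply: filterS Ff => g /=.
  rewrite ltr_pdivlMr// => fg; have := nrm_dual (f - g) y.
  by have := nrm_ge0 (f - g); rewrite /=; nra.
(* Norm closeness of [g] to the members of the filter survives in the pointwise limit. *)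
have close (g : dual Y) e : 0 < e -> F [set f | nrm (g - f) < e] ->
    forall y, nrm (g y - l y) <= e * nrm y.
  move=> e0 Fg y; apply/ler_addgt0Pl => r r0.
  have [f [/= fg fl]] := filter_ex (filterI Fg (lP y _ r0)).
  have := nrm_dist (f y) (g y) (l y); rewrite (nrmBC (f y) (l y)).
  have := nrm_dual (g - f) y; have := nrm_ge0 y; rewrite /=; nra.
have ll : linear l.
  move=> k u v; apply: eq_of_dist => e e0.
  (* Three pointwise errors of size [r] enter with weights 1, [|k|] and 1. *)
  pose r := e / (nrm (k : R[i]^o) + 2).
  have k2 : 0 < nrm (k : R[i]^o) + 2 by rewrite ltr_wpDl ?nrm_ge0.
  have r0 : 0 < r by rewrite divr_gt0.
  have [f [/= fkuv [fu fv]]] := filter_ex (filterI (lP (k *: u + v) _ r0)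
    (filterI (lP u _ r0) (lP v _ r0))).
  rewrite dual_linear in fkuv.
  have -> : l (k *: u + v) - (k *: l u + l v) =
      (l (k *: u + v) - (k *: f u + f v)) - (k *: (l u - f u) + (l v - f v)).
    by rewrite scalerBr [in RHS]addrACA -[in RHS]opprD opprB addrA subrK.
  apply: le_trans (nrmB _ _) _; have := nrmD (k *: (l u - f u)) (l v - f v).
  rewrite nrmZ; have re : r * (nrm (k : R[i]^o) + 2) = e by rewrite divfK// gt_eqF.
  have := nrm_ge0 (k : R[i]^o); nra.
have [g Fg] := Fc _ ltr01.
have [f fl] : exists f : dual Y, f =1 l.
  apply: (@bounded_dual _ (nrm g + 1)) => // y.
  have := close _ _ ltr01 Fg y; have := nrm_dual g y.
  have := nrm_dist (g y) (l y) 0; rewrite !subr0 (nrmBC (l y)); lra.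
apply/cvg_ex; exists f; apply: near_nrm => e e0.
have [h Fh] := Fc _ (divr_gt0 e0 (ltr0Sn R 3)).
apply: filterS (Fh) => f' /= hf'.
apply: le_lt_trans (_ : e / 2 < e); last lra.
have [e4 e2]: 0 < e / 4 /\ 0 <= e / 2 by split; lra.
apply: nrm_dual_le => // y; have := close _ _ e4 Fh y.
rewrite (_ : (f - f') y = l y - f' y) => [hl|]; last by rewrite -fl.
apply: le_trans (nrm_dist (h y) _ _) _; rewrite (nrmBC (l y)).
have := nrm_dual (h - f') y; have := nrm_ge0 y; rewrite /=; nra.
Qed.

HB.instance Definition _ := Uniform_isComplete.Build (dual Y) dual_cauchy_cvg.

End DualComplete.

(** * The left regular module with zero right action, and the bidual *)

Section LeftRegular.
Context {R : realType} (B : normedAlgType R).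

Let lreg_act (b c : B) : B := b ** c.
Let rzero_act (c b : B) : B := 0.

Let lreg_linearl c : linear (lreg_act^~ c).
Proof. by move=> k a b; rewrite /lreg_act amulDl amulZl. Qed.

Let lreg_linearr b : linear (lreg_act b).
Proof. by move=> k a c; rewrite /lreg_act amulDr amulZr. Qed.

Let rzero_linearl b : linear (rzero_act^~ b).
Proof. by move=> k a c; rewrite /rzero_act scaler0 addr0. Qed.

Let rzero_linearr c : linear (rzero_act c).
Proof. by move=> k a b; rewrite /rzero_act scaler0 addr0. Qed.

Let lregA a b c : lreg_act (a ** b) c = lreg_act a (lreg_act b c).
Proof. by rewrite /lreg_act amulA. Qed.

Let rzeroA c a b : rzero_act c (a ** b) = rzero_act (rzero_act c a) b.
Proof. by []. Qed.

Let lreg_rzeroA a c b : rzero_act (lreg_act a c) b = lreg_act a (rzero_act c b).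
Proof. by rewrite /lreg_act /rzero_act amulr0. Qed.

Let lreg_bounded : exists M : R, forall b c, `|lreg_act b c| <= M%:C * `|b| * `|c|.
Proof. by exists 1 => b c; rewrite mul1r; exact: ler_norm_amul. Qed.

Let rzero_bounded : exists M : R, forall c b, `|rzero_act c b| <= M%:C * `|c| * `|b|.
Proof. by exists 0 => c b; rewrite normr0 !mul0r. Qed.

Definition left_regular : bimodule B B :=
  Bimodule lreg_linearl lreg_linearr rzero_linearl rzero_linearr
    lregA rzeroA lreg_rzeroA lreg_bounded rzero_bounded.

End LeftRegular.

Section Evaluation.
Context {R : realType} (V : normedModType R[i]).

Let eval_fun (v : V) (f : dual V) : R[i]^o := f v.

Fact eval_subproof v : eval_fun v \in dual_pred (dual V).
Proof.
apply: (@bounded_dual_pred _ _ _ `|v|) => [//|f].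
by rewrite mulrC; exact: ler_dual_norm.
Qed.

Definition dual_eval (v : V) : dual (dual V) := Dual (eval_subproof v).

Lemma dual_eval_linear : linear dual_eval.
Proof. by move=> k u v; apply: dual_ext => f; exact: dual_linear. Qed.

Lemma nrm_dual_eval v : nrm (dual_eval v) <= nrm v.
Proof.
apply: nrm_dual_le => [|f]; first exact: nrm_ge0.
by rewrite mulrC; exact: (nrm_dual f v).
Qed.

End Evaluation.

(** * Correcting skew-inner derivations into dual modules *)

Section MixedUnit.
Context {R : realType} {B : normedAlgType R} {Y : normedModType R[i]}.
Variables (M : bimodule B Y) (E : dual (dual B)).
Hypothesis E_unit : forall b (f : dual B),
  E (dual_ract (left_regular B) f b) = f b.

(** Put [phi y = (c |-> x (y c))] and [w y = E (phi y)]. The hypothesis gives [phi (b y) = 0], so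
    [w.b = 0]. Moreover [phi (y b)] is [phi y] acted on by [b] from the right, so
    [w (y b) = phi y b = x (y b)] by the property of [E]. *)
Lemma mixed_unit_split (x : dual Y) :
  (forall a b, dual_lact M a (dual_ract M x b) = 0) ->
  exists w, (forall b, dual_ract M w b = 0) /\
            (forall b, dual_lact M b w = dual_lact M b x).
Proof.
move=> axb; have [N Nb] := ract_bounded M.
have nrmN y b : nrm (ract M y b) <= N * nrm y * nrm b.
  by rewrite -lecR !rmorphM /= !nrmE.
have /choice[phi phiE] : forall y, exists f : dual B, f =1 (fun b => x (ract M y b)).
  move=> y; apply: (@bounded_dual _ _ _ (nrm x * (N * nrm y))).
    by move=> k u v; rewrite ract_linearr dual_linear.
  move=> b; apply: le_trans (nrm_dual _ _) _; rewrite -mulrA.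
  by rewrite ler_wpM2l ?nrm_ge0.
have [w wE] : exists w : dual Y, w =1 (fun y => E (phi y)).
  apply: (@bounded_dual _ _ _ (nrm E * (nrm x * `|N|))).
    move=> k u v; rewrite -dual_linear; congr (E _); apply: dual_ext => b.
    by rewrite dualD dualZ !phiE ract_linearl dual_linear.
  move=> y; apply: le_trans (nrm_dual _ _) _; rewrite -mulrA ler_wpM2l ?nrm_ge0//.
  apply: nrm_dual_le => [|b]; first by rewrite !mulr_ge0 ?nrm_ge0.
  rewrite phiE; apply: le_trans (nrm_dual _ _) _; rewrite -!mulrA.
  rewrite ler_wpM2l ?nrm_ge0// mulrA; apply: le_trans (nrmN _ _) _.
  by rewrite -!mulrA ler_wpM2r ?mulr_ge0 ?nrm_ge0 ?ler_norm.
exists w; split=> b; apply: dual_ext => y /=; rewrite wE.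
  rewrite (_ : phi _ = 0) ?dual0; last first.
    apply: dual_ext => c; rewrite phiE lractA.
    exact: (congr1 (fun g : dual Y => g y) (axb c b)).
  exact: (linear0 (to_linear (dual_linear E))).
rewrite -phiE -E_unit; congr (E _); apply: dual_ext => c /=.
by rewrite !phiE ractA.
Qed.

End MixedUnit.

(** * Right units and their bidual analogue from the hypothesis on [A] *)

Section Converse.
Context {R : realType} {A : cstarAlgType R} (s : starHom A).
Local Notation B := (image_alg (starhom_subalg s)).
Local Notation cs := (corestrict (starhom_subalg s)).

(** A limit in [A] of elements of the range is adherent to it, hence lifts. Completeness makes [B]
    an admissible module for contractibility. *)
Lemma image_cauchy_cvg (F : set_system B) : ProperFilter F -> cauchy F -> cvg F.
Proof.
move=> FF /cauchy_nrm Fc.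
have /cauchy_cvg/cvg_ex[l Fl] : cauchy ((val : B -> A) @ F).
  by apply/cauchy_nrm => e /Fc[b Fb]; exists (val b).
have {}Fl (e : R) : 0 < e -> F [set b : B | nrm (l - val b) < e].
  by move=> e0; exact: (cvg_nrm _ Fl e0).
have [e e0|a al _] := @lift_bounded _ _ s l.
  have [[b bP] lb] := filter_ex (Fl _ e0); have /asboolP[a _ ab] := bP.
  by exists a; rewrite [s a]ab ltW.
apply/cvg_ex; exists (cs a); apply: near_nrm => e /Fl.
by apply: filterS => b; rewrite /= -al.
Qed.

Definition image_complete : completeNormedModType R[i] :=
  HB.pack (B : normedModType R[i]) (Uniform_isComplete.Build B image_cauchy_cvg).

(** For zero right action a homomorphism is a derivation, and inner and skew-inner differ only by
    the sign of the implementing element. *)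
Lemma contractible_right_unit : sigma_contractible (starhom_subalg s) ->
  exists u : B, forall b, b ** u = b.
Proof.
pose D : {linear A -> B} := to_linear (corestrict_linear s).
have cD : continuous D.
  by apply: (@bounded_continuous _ _ _ _ 4) => a; exact: starhom_bounded.
have DD : derivation cs (left_regular B) D.
  by move=> a b; rewrite /= corestrictM add0r.
move=> /(_ image_complete (left_regular B) D cD DD)[] [u uP].
  exists (- u) => b; have [a <- _] := corestrict_lift b.
  have ua : cs a = 0 - cs a ** u := uP a.
  by rewrite amulrN [RHS]ua sub0r.
exists u => b; have [a <- _] := corestrict_lift b.
have ua : cs a = 0 + cs a ** u := uP a.
by rewrite [RHS]ua add0r.
Qed.

(** The same argument with the canonical embedding into the bidual as derivation; [E] stands in for
    a bounded right approximate unit. *)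
Lemma amenable_mixed_unit : sigma_amenable (starhom_subalg s) ->
  exists E : dual (dual B), forall b (f : dual B),
    E (dual_ract (left_regular B) f b) = f b.
Proof.
have lD : linear (fun a => dual_eval (cs a)).
  by move=> k a b; rewrite corestrict_linear dual_eval_linear.
pose D := to_linear lD; pose M := dual_bimodule (left_regular B).
have cD : continuous D.
  apply: (@bounded_continuous _ _ _ _ 4) => a /=.
  by apply: le_trans (nrm_dual_eval _) _; exact: starhom_bounded.
have f0 (V : normedModType R[i]) (f : dual V) : f 0 = 0.
  exact: (linear0 (to_linear (dual_linear f))).
(* The zero right action on [B] becomes a zero left action on the dual, then a zero right action on
   the bidual. *)
have lM0 b (f : dual B) : dual_lact (left_regular B) b f = 0.
  by apply: dual_ext => y; exact: f0.
have DD : derivation cs (dual_bimodule M) D.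
  move=> a b; apply: dual_ext => f.
  change (f (cs (a ** b)) =
    dual_lact (left_regular B) (cs b) f (cs a) + f (cs a ** cs b)).
  by rewrite lM0 dual0 add0r corestrictM.
move=> /(_ (dual B) M D cD DD)[] [E EP].
  exists (- E) => b f; have [a <- _] := corestrict_lift b.
  have fa : f (cs a) = E (dual_lact (left_regular B) (cs a) f)
      - E (dual_ract (left_regular B) f (cs a)).
    exact: (congr1 (fun g : dual (dual B) => g f) (EP a)).
  by rewrite fa lM0 f0 sub0r.
exists E => b f; have [a <- _] := corestrict_lift b.
have fa : f (cs a) = E (dual_lact (left_regular B) (cs a) f)
    + E (dual_ract (left_regular B) f (cs a)).
  exact: (congr1 (fun g : dual (dual B) => g f) (EP a)).
by rewrite fa lM0 f0 add0r.
Qed.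

End Converse.

(** * Assembly of the two equivalences *)

Lemma inner_corestrict (R : realType) (A : cstarAlgType R) (s : starHom A)
    (X : normedModType R[i]) (M : bimodule (image_alg (starhom_subalg s)) X)
    (D : A -> X) (d : image_alg (starhom_subalg s) -> X) :
  (forall a, D a = d (corestrict (starhom_subalg s) a)) ->
  [/\ inner (corestrict (starhom_subalg s)) M D -> inner idfun M d,
      skew_inner (corestrict (starhom_subalg s)) M D -> skew_inner idfun M d
    & inner idfun M d -> inner (corestrict (starhom_subalg s)) M D].
Proof.
move=> Dd; split=> -[x xP]; exists x.
- by move=> b; have [a <- _] := corestrict_lift b; rewrite -Dd xP.
- by move=> b; have [a <- _] := corestrict_lift b; rewrite -Dd xP.
- by move=> a; rewrite Dd xP.
Qed.

Theorem corollary4p4 (R : realType) (A : cstarAlgType R) (sigma : starHom A) :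
  (sigma_amenable (starhom_subalg sigma)
     <-> amenable (image_alg (starhom_subalg sigma)))
  /\ (sigma_contractible (starhom_subalg sigma)
     <-> contractible (image_alg (starhom_subalg sigma))).
Proof.
split; split.
- move=> am Y M d cd dd; have [D [cD DD Dd]] := derivation_lift cd dd.
  have [inn skew _] := inner_corestrict (dual_bimodule M) Dd.
  have [/inn//|/skew[x dx]] := am Y M D cD DD.
  have [E Eu] := amenable_mixed_unit am.
  have [w [w0 wx]] := mixed_unit_split Eu (skew_vanish dd dx).
  exact: (skew_to_inner dx w0 wx).
- move=> am Y M D cD DD; have [d [cd dd Dd]] := derivation_factor cD DD.
  by left; have [_ _] := inner_corestrict (dual_bimodule M) Dd; apply; exact: am.
- move=> co X M d cd dd; have [D [cD DD Dd]] := derivation_lift cd dd.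
  have [inn skew _] := inner_corestrict M Dd.
  have [/inn//|/skew[x dx]] := co X M D cD DD.
  have [u uP] := contractible_right_unit co.
  apply: (@skew_to_inner _ _ _ M d x (lact M u x)) => // b.
    by rewrite lractA; exact: skew_vanish dx _ _.
  by rewrite -lactA uP.
- move=> co X M D cD DD; have [d [cd dd Dd]] := derivation_factor cD DD.
  by left; have [_ _] := inner_corestrict M Dd; apply; exact: co.
Qed.
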